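(* Let $D$ be an integral domain, let $D[X]$ be the polynomial ring in one indeterminate over $D$, let $A=\{f\in D[X] \mid f(0)=1\}$, and let $D[X]_A$ be the ring of fractions of $D[X]$ with respect to $A$. Then the following assertions are equivalent. (1) $D$ is a $w$-Hilbert domain, and every prime $w$-ideal of $D[X]$ is either the extension $PD[X]$ of a prime $w$-ideal $P$ of $D$ or an upper to zero in $D[X]$ which is a maximal $w$-ideal of $D[X]$. (2) $D$ is a $w$-Hilbert domain, and every prime $w$-ideal of $D[X]_A$ is either the extension $PD[X]_A$ of a prime $w$-ideal $P$ of $D$ or the extension $\mathfrak{q}D[X]_A$ of an upper to zero $\mathfrak{q}$ in $D[X]$ which is a maximal $w$-ideal of $D[X]$ and is disjoint from $A$. (3) $D[X]$ is a $w$-Hilbert domain. (4) $D[X]_A$ is a $w$-Hilbert domain.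
   Context: Let $R$ be an integral domain with quotient field $F$ (applied below to $R=D$, $D[X]$, $D[X]_A$, each with respect to its own quotient field). For a nonzero fractional ideal $I$ of $R$ put $I^{-1}=\{a\in F \mid aI\subseteq R\}$. A Glaz-Vasconcelos ideal (GV-ideal) of $R$ is a (nonzero) finitely generated ideal $J$ of $R$ with $J^{-1}=R$; the set of these is $\mathrm{GV}(R)$. The $w$-envelope of a nonzero fractional ideal $I$ is $I_w=\{a\in F \mid aJ\subseteq I \text{ for some } J\in \mathrm{GV}(R)\}$. An ideal $I$ of $R$ is a $w$-ideal if $I_w=I$; since the $w$-operation is defined only on nonzero fractional ideals, $w$-ideals are nonzero. A maximal $w$-ideal is a proper $w$-ideal that is not properly contained in any proper $w$-ideal. A prime $w$-ideal is an ideal that is both a prime ideal and a $w$-ideal (in particular, it is nonzero). $R$ is a $w$-Hilbert domain if every prime $w$-ideal of $R$ can be expressed as an intersection of maximal $w$-ideals of $R$. An upper to zero in $D[X]$ is a nonzero prime ideal $\mathfrak{q}$ of $D[X]$ with $\mathfrak{q}\cap D=(0)$. The set $A$ is a multiplicative subset of $D[X]$, and $D[X]_A$ is called the Anderson ring of $D$. *)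

(* Defs.v *)
From HB Require Import structures.
From mathcomp Require Import all_boot all_algebra.
From mathcomp Require Import boolp classical_sets.

Set Implicit Arguments.
Unset Strict Implicit.
Unset Printing Implicit Defensive.

Import GRing.Theory.

Local Open Scope classical_set_scope.
Local Open Scope ring_scope.

Notation "x %:F" := (@FracField.tofrac _ x) : ring_scope.

(** ** Ideals

    Ideals are classical sets; unlike [idealr] of [ring_quotient], [is_ideal]
    allows the unit ideal, which is needed for GV-ideals. *)

Definition is_ideal (R : idomainType) (I : set R) : Prop :=
  [/\ I 0, forall x y, I x -> I y -> I (x + y) & forall a x, I x -> I (a * x)].

Definition is_proper_ideal (R : idomainType) (I : set R) : Prop :=
  is_ideal I /\ I <> setT.

Definition is_prime_ideal (R : idomainType) (P : set R) : Prop :=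
  is_proper_ideal P /\ forall x y, P (x * y) -> P x \/ P y.

Definition ideal_gen (R : idomainType) (S : set R) : set R :=
  smallest (@is_ideal R) S.

Definition finitely_generated (R : idomainType) (I : set R) : Prop :=
  exists s : seq R, I = ideal_gen [set` s].

Definition ideal_ext (R S : idomainType) (phi : {rmorphism R -> S})
    (I : set R) : set S :=
  ideal_gen (phi @` I).

(** ** The w-operation

    Fractional ideals of [R] are subsets of [{fraction R}]; an ideal [I] of [R]
    is regarded as the fractional ideal [frac_set I].  The operations below are
    total on subsets of [{fraction R}]; they are only applied to [frac_set I]
    for [I] a nonzero ideal. *)

Definition frac_set (R : idomainType) (I : set R) : set {fraction R} :=
  [set x%:F | x in I].

Definition frac_inv (R : idomainType) (I : set {fraction R}) :
    set {fraction R} :=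
  [set a | [set a * x | x in I] `<=` frac_set [set: R]].

Definition GV_ideal (R : idomainType) (J : set R) : Prop :=
  [/\ is_ideal J, J <> [set 0], finitely_generated J
    & frac_inv (frac_set J) = frac_set [set: R]].

Definition w_env (R : idomainType) (I : set {fraction R}) :
    set {fraction R} :=
  [set a | exists2 J : set R,
     GV_ideal J & [set a * x | x in frac_set J] `<=` I].

Definition w_ideal (R : idomainType) (I : set R) : Prop :=
  [/\ is_ideal I, I <> [set 0] & w_env (frac_set I) = frac_set I].

Definition maximal_w_ideal (R : idomainType) (M : set R) : Prop :=
  [/\ w_ideal M, M <> setT
    & forall I : set R, w_ideal I -> I <> setT -> ~ M `<` I].

Definition prime_w_ideal (R : idomainType) (P : set R) : Prop :=
  is_prime_ideal P /\ w_ideal P.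

(* The empty family has intersection [setT], hence never expresses a prime. *)
Definition w_Hilbert (R : idomainType) : Prop :=
  forall P : set R, prime_w_ideal P ->
  exists2 C : set (set R),
    C `<=` @maximal_w_ideal R & P = \bigcap_(M in C) M.

Definition upper_to_zero (D : idomainType) (q : set {poly D}) : Prop :=
  [/\ is_prime_ideal q, q <> [set 0] & (@polyC D) @^-1` q = [set 0]].

(** ** The Anderson ring

    [D[X]_A] is realised as the subring of the quotient field of [D[X]]
    consisting of the fractions with denominator in [A]. *)

Definition anderson_set (D : idomainType) : set {poly D} :=
  [set f | f.[0] = 1].

Definition anderson_pred (D : idomainType) : {pred {fraction {poly D}}} :=
  fun x => `[< exists f g : {poly D}, anderson_set g /\ x = f%:F / g%:F >].
Arguments anderson_pred D : clear implicits.

Record anderson (D : idomainType) := Anderson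
  { anderson_val :> {fraction {poly D}} ;
    _ : anderson_val \in anderson_pred D }.

HB.instance Definition _ (D : idomainType) :=
  [isSub for @anderson_val D].
HB.instance Definition _ (D : idomainType) :=
  [Choice of anderson D by <:].

Lemma anderson_set1 (D : idomainType) : anderson_set (1 : {poly D}).
Proof. by rewrite /anderson_set /= hornerC. Qed.

Lemma anderson_setM (D : idomainType) (f g : {poly D}) :
  anderson_set f -> anderson_set g -> anderson_set (f * g).
Proof. by rewrite /anderson_set /= hornerM => -> ->; rewrite mulr1. Qed.

Lemma anderson_set_neq0 (D : idomainType) (g : {poly D}) :
  anderson_set g -> g%:F != 0.
Proof.
rewrite /anderson_set /= tofrac_eq0 => h; apply/eqP => g0.
by move: h; rewrite g0 horner0 => /eqP; rewrite eq_sym oner_eq0.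
Qed.

Lemma anderson_predP (D : idomainType) (x : {fraction {poly D}}) :
  reflect (exists f g : {poly D}, anderson_set g /\ x = f%:F / g%:F)
          (x \in anderson_pred D).
Proof. exact: asboolP. Qed.

Lemma anderson_subring_closed (D : idomainType) :
  subring_closed (anderson_pred D).
Proof.
split.
- apply/anderson_predP; exists 1, 1; split; first exact: anderson_set1.
  by rewrite tofrac1 divr1.
- move=> _ _ /anderson_predP[f [g [Ag ->]]] /anderson_predP[h [k [Ak ->]]].
  apply/anderson_predP; exists (f * k - h * g), (g * k).
  split; first exact: anderson_setM.
  have g0 := anderson_set_neq0 Ag; have k0 := anderson_set_neq0 Ak.
  rewrite tofracB 3!tofracM; move: g0 k0.
  by move: f%:F g%:F h%:F k%:F => a b c d b0 d0; rewrite -mulNr addf_div // mulNr.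
- move=> _ _ /anderson_predP[f [g [Ag ->]]] /anderson_predP[h [k [Ak ->]]].
  apply/anderson_predP; exists (f * h), (g * k).
  split; first exact: anderson_setM.
  by rewrite 2!tofracM mulf_div.
Qed.

HB.instance Definition _ (D : idomainType) :=
  GRing.SubChoice_isSubComNzRing.Build {fraction {poly D}}
    (anderson_pred D) (anderson D) (anderson_subring_closed D).

Definition anderson_unit (D : idomainType) : {pred anderson D} :=
  fun x => (val x != 0) && ((val x)^-1 \in anderson_pred D).
Arguments anderson_unit D : clear implicits.

Definition anderson_inv (D : idomainType) (x : anderson D) : anderson D :=
  if x \in anderson_unit D then insubd x (val x)^-1 else x.

Lemma anderson_mulVx (D : idomainType) :
  {in anderson_unit D, left_inverse 1 (@anderson_inv D) *%R}.
Proof.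
move=> x ux; apply: val_inj; rewrite /anderson_inv ux rmorphM rmorph1 /=.
by case/andP: ux => x0 xA; rewrite [val _]insubdK // mulVf.
Qed.

Lemma anderson_unitPl (D : idomainType) (x y : anderson D) :
  y * x = 1 -> anderson_unit D x.
Proof.
move=> /(congr1 val); rewrite rmorphM rmorph1 /= => yx1.
have x0 : val x != 0.
  by apply/eqP => x0; move/eqP: yx1; rewrite x0 mulr0 eq_sym oner_eq0.
rewrite /anderson_unit x0 /=.
by rewrite -[_^-1]mul1r -yx1 mulfK //; apply: valP.
Qed.

Lemma anderson_invr_out (D : idomainType) :
  {in [predC anderson_unit D], @anderson_inv D =1 id}.
Proof. by move=> x; rewrite inE /anderson_inv => /negbTE ->. Qed.

HB.instance Definition _ (D : idomainType) :=
  GRing.ComNzRing_hasMulInverse.Build (anderson D)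
    (@anderson_mulVx D) (@anderson_unitPl D) (@anderson_invr_out D).

Lemma anderson_integral (D : idomainType) :
  GRing.integral_domain_axiom (anderson D).
Proof.
move=> x y /(congr1 val) /eqP; rewrite rmorphM rmorph0 mulf_eq0.
by rewrite -!(inj_eq val_inj) rmorph0.
Qed.

HB.instance Definition _ (D : idomainType) :=
  GRing.ComUnitRing_isIntegral.Build (anderson D) (@anderson_integral D).

Lemma anderson_of_subproof (D : idomainType) (f : {poly D}) :
  f%:F \in anderson_pred D.
Proof.
apply/anderson_predP; exists f, 1; split; first exact: anderson_set1.
by rewrite tofrac1 divr1.
Qed.

(* The canonical morphism from [D[X]] to [D[X]_A]. *)
Definition anderson_of (D : idomainType) (f : {poly D}) : anderson D :=
  Anderson (anderson_of_subproof f).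

Lemma anderson_of_zmod_morphism (D : idomainType) :
  zmod_morphism (@anderson_of D).
Proof. by move=> f g; apply: val_inj; rewrite rmorphB /= tofracB. Qed.

Lemma anderson_of_monoid_morphism (D : idomainType) :
  monoid_morphism (@anderson_of D).
Proof.
split; first by apply: val_inj; rewrite rmorph1 /= tofrac1.
by move=> f g; apply: val_inj; rewrite rmorphM /= tofracM.
Qed.

HB.instance Definition _ (D : idomainType) :=
  GRing.isZmodMorphism.Build {poly D} (anderson D) (@anderson_of D)
    (@anderson_of_zmod_morphism D).
HB.instance Definition _ (D : idomainType) :=
  GRing.isMonoidMorphism.Build {poly D} (anderson D) (@anderson_of D)
    (@anderson_of_monoid_morphism D).

Lemma anderson_of_unit (D : idomainType) (g : {poly D}) :
  anderson_set g -> anderson_of g \is a GRing.unit.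
Proof.
move=> Ag; apply/andP; split; first exact: anderson_set_neq0.
apply/anderson_predP; exists 1, g; split=> //.
by rewrite tofrac1 div1r.
Qed.

Lemma andersonP (D : idomainType) (x : anderson D) :
  exists f g : {poly D}, anderson_set g /\ x = anderson_of f / anderson_of g.
Proof.
have /anderson_predP[f [g [Ag xE]]] := valP x; exists f, g; split=> //.
have ug := anderson_of_unit Ag; apply: (mulIr ug); rewrite divrK //.
apply: val_inj; rewrite rmorphM /= -[anderson_val x]/(val x) xE divfK //.
exact: anderson_set_neq0.
Qed.

(* Main.v *)
Require Import Defs.
From HB Require Import structures.
From mathcomp Require Import all_boot all_algebra.
From mathcomp Require Import boolp classical_sets.
From mathcomp Require Import ring.

(* Both [D[X]] and the Anderson ring are localizations [T] of [D[X]] at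
   polynomials with constant term 1, and the argument is uniform in [T].  By
   McCoy's theorem, a nonzero constant together with a polynomial whose
   coefficients generate a GV-ideal of [D] generates a GV-ideal of [T].  Hence a
   proper [w]-ideal of [T] meeting [D] nontrivially lies in [NT], where the proper
   [w]-ideal [N] of [D] is the [w]-closure of the ideal of coefficients; so the
   maximal [w]-ideals of [T] meeting [D] nontrivially are the extensions of those
   of [D], and a prime [w]-ideal of [T] meeting [D] trivially is a maximal
   [w]-ideal iff its contraction to [D[X]] lies in no such [N[X]].  The latter
   condition does not depend on [T]. *)

Set Implicit Arguments.
Unset Strict Implicit.
Unset Printing Implicit Defensive.

Import GRing.Theory Pdiv.CommonRing Pdiv.ComRing.

Local Open Scope classical_set_scope.
Local Open Scope ring_scope.

(** * Ideals *)

Section Ideals.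
Variable R : idomainType.
Implicit Types (I J : set R) (x y z : R) (s t : seq R).

Definition divides x y : Prop := exists z, y = x * z.

Lemma divides0 x : divides x 0.
Proof. by exists 0; rewrite mulr0. Qed.

Lemma divides_ideal x : is_ideal [set y | divides x y].
Proof.
split=> [|_ _ [u ->] [v ->]|a _ [u ->]] /=; first exact: divides0.
- by exists (u + v); rewrite mulrDr.
- by exists (a * u); rewrite mulrCA.
Qed.

Lemma ideal_colon I x : is_ideal I -> is_ideal [set y | I (x * y)].
Proof.
move=> [I0 ID IM]; split=> [|y z Iy Iz|a y Iy] /=; first by rewrite mulr0.
- by rewrite mulrDr; apply: ID.
- by rewrite mulrCA; apply: IM.
Qed.

Lemma ideal_mulr I a x : is_ideal I -> I x -> I (x * a).
Proof. by move=> [_ _ IM] Ix; rewrite mulrC; apply: IM. Qed.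

Lemma ideal_opp I x : is_ideal I -> I x -> I (- x).
Proof. by move=> [_ _ IM] Ix; rewrite -mulN1r; apply: IM. Qed.

Lemma ideal_sum I (T : Type) (r : seq T) (P : pred T) (F : T -> R) :
  is_ideal I -> (forall i, P i -> I (F i)) -> I (\sum_(i <- r | P i) F i).
Proof. by move=> [I0 ID _] IF; elim/big_ind: _. Qed.

Lemma ideal_gen_ideal (S : set R) : is_ideal (ideal_gen S).
Proof.
split=> [J [[]]//|x y Sx Sy J SJ|a x Sx J SJ]; have [[_ JD JM] _] := SJ.
- by apply: JD; [apply: Sx|apply: Sy].
- by apply: JM; apply: Sx.
Qed.

Lemma ideal_nonzero I : is_ideal I ->
  (I <> [set 0]) <-> (exists2 x, I x & x != 0).
Proof.
move=> [I0 _ _]; split=> [In0|[x Ix xn0] IE]; last first.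
  by move: Ix; rewrite IE /= => x0; rewrite x0 eqxx in xn0.
apply: contrapT => nI; apply: In0; apply/seteqP; split=> [x Ix|_ ->//].
by apply/eqP; apply/negPn/negP => xn0; apply: nI; exists x.
Qed.

Lemma ideal_proper I : is_ideal I -> (I <> setT) <-> ~ I 1.
Proof.
move=> [_ _ IM]; split=> [IT I1|I1 IT]; last by apply: I1; rewrite IT.
by apply: IT; apply/seteqP; split=> // x _; rewrite -[x]mulr1; apply: IM.
Qed.

Lemma bigcap_ideal (K : set (set R)) :
  (forall I, K I -> is_ideal I) -> is_ideal (\bigcap_(N in K) N).
Proof.
move=> Ki; split=> [N /Ki[]//|x y Kx Ky N KN|a x Kx N KN]; have [_ ND NM] := Ki _ KN.
- by apply: ND; [apply: Kx|apply: Ky].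
- by apply: NM; apply: Kx.
Qed.

End Ideals.

Lemma ideal_preimage (R S : idomainType) (phi : {rmorphism R -> S}) (I : set S) :
  is_ideal I -> is_ideal (phi @^-1` I).
Proof.
move=> [I0 ID IM]; split=> [|x y Ix Iy|a x Ix] /=; first by rewrite rmorph0.
- by rewrite rmorphD; apply: ID.
- by rewrite rmorphM; apply: IM.
Qed.

Lemma prime_preimage (R S : idomainType) (phi : {rmorphism R -> S}) (I : set S) :
  is_prime_ideal I -> is_prime_ideal (phi @^-1` I).
Proof.
move=> [[Ii /(ideal_proper Ii) I1] IP]; split.
  split; first exact: ideal_preimage.
  by apply/ideal_proper; [exact: ideal_preimage|rewrite /= rmorph1].
by move=> x y /=; rewrite rmorphM; apply: IP.
Qed.

(** * GV-sequences *)

Section GVseq.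
Variable R : idomainType.
Implicit Types (I J : set R) (x y z : R) (s t : seq R).

(* [s] generates a GV-ideal: the fraction [x / y] lies in the inverse of the
   ideal generated by [s] iff [y] divides [x * j] for all [j] in [s]. *)
Definition GV_seq s : Prop :=
  (exists2 j, j \in s & j != 0) /\
  forall x y, y != 0 -> (forall j, j \in s -> divides y (x * j)) -> divides y x.

Lemma GV_seq1 : GV_seq [:: 1].
Proof.
split=> [|x y _ /(_ 1)]; first by exists 1; rewrite ?inE ?oner_eq0.
by rewrite inE eqxx mulr1; apply.
Qed.

Lemma GV_seq_mul s t : GV_seq s -> GV_seq t ->
  GV_seq [seq j * k | j <- s, k <- t].
Proof.
move=> [[j js j0] sP] [[k kt k0] tP]; split=> [|x y y0 xyP].
  by exists (j * k); [apply: allpairs_f|rewrite mulf_neq0].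
apply: (sP _ _ y0) => i si; apply: (tP _ _ y0) => l tl.
by rewrite -mulrA; apply: xyP; apply: allpairs_f.
Qed.

(** The ideal generated by [t] contains the one generated by [s], and a finitely generated ideal
    containing a GV-ideal is a GV-ideal. *)
Lemma GV_seq_divides s t :
  (forall j, j \in s -> j != 0 -> exists2 k, k \in t & divides k j) ->
  GV_seq s -> GV_seq t.
Proof.
move=> st [[j js j0] sP]; split=> [|x y y0 xyP].
  have [k kt [z jE]] := st _ js j0; exists k => //.
  by apply: contra_neq j0 => kE; rewrite jE kE mul0r.
apply: (sP _ _ y0) => i si; have [->|i0] := eqVneq i 0.
  by rewrite mulr0; apply: divides0.
have [k kt [z ->]] := st _ si i0; have [u uE] := xyP _ kt.
by exists (u * z); rewrite mulrA uE mulrA.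
Qed.

Lemma fractionP (a : {fraction R}) : exists x y, y != 0 /\ a = x%:F / y%:F.
Proof.
elim/quotW: a => r; exists (\n_r), (\d_r); split; first exact: denom_ratioP.
have d0 : (\d_r)%:F != 0 :> {fraction R} by rewrite tofrac_eq0 denom_ratioP.
apply: (mulIf d0); rewrite divfK //; unlock FracField.tofrac.
rewrite -[LHS]FracField.pi_mul; apply/eqmodP; rewrite /= FracField.equivfE.
rewrite /FracField.mulf !numden_Ratio ?oner_neq0 ?mulr1 ?mul1r ?denom_ratioP //.
by rewrite mulrC.
Qed.

Lemma frac_setP I x : frac_set I x%:F <-> I x.
Proof.
split=> [[y Iy /eqP]|Ix]; last by exists x.
by rewrite tofrac_eq => /eqP <-.
Qed.

Lemma ideal_gen_colon I s x : is_ideal I ->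
  (forall j, j \in s -> I (x * j)) -> forall y, ideal_gen [set` s] y -> I (x * y).
Proof.
move=> Ii sI; apply: (@smallest_sub _ _ _ [set y | I (x * y)]) => //.
exact: ideal_colon.
Qed.

Lemma frac_inv_gen s (a : {fraction R}) :
  frac_inv (frac_set (ideal_gen [set` s])) a <->
  exists x y, [/\ y != 0, a = x%:F / y%:F &
                  forall j, j \in s -> divides y (x * j)].
Proof.
split=> [aP|[x [y [y0 -> xyP]]] _ [_ [j sj <-] <-]].
  have [x [y [y0 aE]]] := fractionP a; exists x, y; split=> // j sj.
  have /aP[z _ zE] : [set a * u | u in frac_set (ideal_gen [set` s])] (a * j%:F).
    by exists j%:F => //; exists j => //; apply: sub_gen_smallest.
  exists z; apply/eqP; rewrite -tofrac_eq !tofracM zE aE.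
  by rewrite mulrAC [y%:F * _]mulrC divfK // tofrac_eq0.
have [z zE] := ideal_gen_colon (divides_ideal y) xyP sj.
by exists z => //; rewrite mulrAC -tofracM zE tofracM mulrAC divff ?mul1r ?tofrac_eq0.
Qed.

Lemma GV_ideal_gen s : GV_ideal (ideal_gen [set` s]) <-> GV_seq s.
Proof.
have gi := ideal_gen_ideal [set` s].
have sg j : j \in s -> ideal_gen [set` s] j by move=> sj; apply: sub_gen_smallest.
split=> [[_ /(ideal_nonzero gi)[z gz z0] _ invE]|[[j js j0] sP]].
  split=> [|x y y0 xyP].
    apply: contrapT => ns; move: z0; have [<-] : [set 0 : R] z; last by rewrite eqxx.
    move: z gz; apply: smallest_sub => [|j sj].
      split=> [//|_ _ -> ->|a _ ->] /=; first by rewrite addr0.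
      by rewrite mulr0.
    by apply/eqP; apply/negPn/negP => j0; apply: ns; exists j.
  have : frac_inv (frac_set (ideal_gen [set` s])) (x%:F / y%:F).
    by apply/frac_inv_gen; exists x, y.
  rewrite invE => -[u _ uE]; exists u; apply/eqP; rewrite -tofrac_eq tofracM uE.
  by rewrite mulrC divfK // tofrac_eq0.
split=> //; first by apply/(ideal_nonzero gi); exists j; auto.
  by exists s.
apply/seteqP; split=> [a /frac_inv_gen[x [y [y0 -> /(sP _ _ y0)[z ->]]]]|_ [z _ <-]].
  by exists z => //; rewrite tofracM mulrAC divff ?mul1r // tofrac_eq0.
apply/frac_inv_gen; exists z, 1; rewrite oner_neq0 tofrac1 divr1; split=> // k _.
by exists (z * k); rewrite mul1r.
Qed.

(** A fraction [a] with [aJ] inside [I] lies in the inverse of [J], which is [R]. So the envelope of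
    an ideal consists of ring elements, and the property can be tested without fractions. *)
Lemma w_idealP I : w_ideal I <->
  [/\ is_ideal I, I <> [set 0] &
     forall s x, GV_seq s -> (forall j, j \in s -> I (x * j)) -> I x].
Proof.
split=> [[Ii I0 wI]|[Ii I0 wI]]; split=> //.
  move=> s x /GV_ideal_gen sGV xsI; apply/frac_setP; rewrite -wI.
  exists (ideal_gen [set` s]) => // _ [_ [y sy <-] <-].
  by rewrite -tofracM; apply/frac_setP; apply: ideal_gen_colon sy.
apply/seteqP; split=> [a [J JGV aJ]|_ [x Ix <-]]; last first.
  exists (ideal_gen [set` [:: 1]]); first by apply/GV_ideal_gen/GV_seq1.
  move=> _ [_ [y sy <-] <-]; rewrite -tofracM; apply/frac_setP.
  exact: ideal_mulr.
have [_ _ [s JE] invE] := JGV.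
have : frac_inv (frac_set J) a by move=> b /aJ[x _ <-]; exists x.
rewrite invE => -[x _ xE]; rewrite -xE; apply/frac_setP; apply: (wI s).
  by apply/GV_ideal_gen; rewrite -JE.
move=> j sj; apply/frac_setP; rewrite tofracM xE; apply: aJ; exists j%:F => //.
by apply/frac_setP; rewrite JE; apply: sub_gen_smallest.
Qed.

(** If [x] multiplies a GV-sequence into [P] and is not itself in [P], primality puts the whole
    sequence in [P]. *)
Lemma prime_w_idealP P : is_prime_ideal P -> P <> [set 0] ->
  (forall s, GV_seq s -> ~ (forall j, j \in s -> P j)) -> prime_w_ideal P.
Proof.
move=> Pp P0 nGV; split=> //; apply/w_idealP; split=> //; first by case: Pp => [[]].
move=> s x sGV xsP; apply: contrapT => nPx; apply: (nGV _ sGV) => j sj.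
by case: Pp => _ /(_ _ _ (xsP _ sj))[].
Qed.

Lemma w_ideal_noGV I s : w_ideal I -> I <> setT -> GV_seq s ->
  ~ (forall j, j \in s -> I j).
Proof.
move=> /w_idealP[Ii _ wI] /(ideal_proper Ii) I1 sGV sI; apply: I1.
by apply: (wI _ _ sGV) => j sj; rewrite mul1r; apply: sI.
Qed.

(** The envelope of [I], taken inside [R]. *)
Definition w_closure I : set R :=
  [set x | exists2 s, GV_seq s & forall j, j \in s -> I (x * j)].

Lemma sub_w_closure I : is_ideal I -> I `<=` w_closure I.
Proof. by move=> Ii x Ix; exists [:: 1]; [exact: GV_seq1|move=> j _; apply: ideal_mulr]. Qed.

Lemma w_closure_ideal I : is_ideal I -> is_ideal (w_closure I).
Proof.
move=> Ii; have [I0 ID IM] := Ii; split=> [|x y [s sGV xs] [t tGV yt]|a x [s sGV xs]].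
- exact: sub_w_closure.
- exists [seq j * k | j <- s, k <- t]; first exact: GV_seq_mul.
  move=> _ /allpairsP[[j k] /= [sj tk ->]]; rewrite mulrDl; apply: ID.
    by rewrite mulrA; apply: ideal_mulr => //; apply: xs.
  by rewrite mulrCA; apply: IM; apply: yt.
- by exists s => // j sj; rewrite -mulrA; apply: IM; apply: xs.
Qed.

Lemma w_closure_w_ideal I : is_ideal I -> I <> [set 0] -> w_ideal (w_closure I).
Proof.
move=> Ii I0; apply/w_idealP; split; first exact: w_closure_ideal.
  move/(ideal_nonzero Ii): I0 => [x Ix x0].
  by apply/(ideal_nonzero (w_closure_ideal Ii)); exists x => //; apply: sub_w_closure.
move=> s x sGV xs.
(* Each [x * j] has its own GV-sequence; the product of these finitely many sequences serves all [j]
   at once. *)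
have [t tGV xst] : exists2 t, GV_seq t &
    forall j k, j \in s -> k \in t -> I (x * j * k).
  elim: s xs {sGV} => [_|j s IHs xs].
    by exists [:: 1] => //; exact: GV_seq1.
  have [t tGV xst] := IHs (fun k ks => xs k (mem_behead (s := j :: s) ks)).
  have [u uGV xju] := xs j (mem_head j s).
  exists [seq k * l | k <- u, l <- t]; first exact: GV_seq_mul.
  move=> i _ si /allpairsP[[k l] /= [uk tl ->]].
  move: si; rewrite inE => /predU1P[->|si].
    by rewrite mulrA; apply: ideal_mulr => //; apply: xju.
  by rewrite mulrCA; case: Ii => _ _; apply; apply: xst.
exists [seq j * k | j <- s, k <- t]; first exact: GV_seq_mul.
by move=> _ /allpairsP[[j k] /= [sj tk ->]]; rewrite mulrA; apply: xst.
Qed.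

Lemma w_closure_proper I : is_ideal I ->
  (forall s, GV_seq s -> ~ (forall j, j \in s -> I j)) -> w_closure I <> setT.
Proof.
move=> Ii nGV; apply/(ideal_proper (w_closure_ideal Ii)) => -[s sGV sI].
by apply: (nGV s sGV) => j sj; rewrite -[j]mul1r; apply: sI.
Qed.

Lemma w_ideal_bigcap (C : set (set R)) : \bigcap_(M in C) M <> [set 0] ->
  C `<=` @w_ideal R -> w_ideal (\bigcap_(M in C) M).
Proof.
move=> C0 Cw; apply/w_idealP; split=> //.
  by apply: bigcap_ideal => M /Cw[].
move=> s x sGV xsC M CM; have /w_idealP[_ _ wM] := Cw _ CM.
by apply: (wM _ _ sGV) => j sj; apply: xsC.
Qed.

Lemma maximal_w_ideal_sub I J :
  maximal_w_ideal I -> w_ideal J -> J <> setT -> I `<=` J -> I = J.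
Proof.
move=> [_ _ Imax] Jw JT IJ; apply: contrapT => neIJ; apply: (Imax _ Jw JT).
by rewrite properEneq; split=> //; apply/eqP.
Qed.

End GVseq.

(** * Polynomials *)

Section Polynomials.
Variable D : idomainType.
Implicit Types (N : set D) (I q : set {poly D}) (f g h : {poly D}).

Definition poly_ext N : set {poly D} := [set f | forall i, N f`_i].

Lemma poly_extC N r : is_ideal N -> poly_ext N r%:P <-> N r.
Proof.
move=> [N0 _ _]; split=> [/(_ 0)|Nr i]; rewrite coefC //.
by case: eqP.
Qed.

Lemma poly_ext_ideal N : is_ideal N -> is_ideal (poly_ext N).
Proof.
move=> Ni; have [N0 ND NM] := Ni; split=> [i|f g Nf Ng i|f g Ng i].
- by rewrite coef0.
- by rewrite coefD; apply: ND.
- by rewrite coefM; apply: ideal_sum => // j _; apply: NM.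
Qed.

(* McCoy's theorem for [g] and [f] modulo [N]. *)
Lemma poly_ext_mul_content N f g : is_ideal N ->
  (forall r, (forall i, N (r * f`_i)) -> N r) ->
  poly_ext N (g * f) -> poly_ext N g.
Proof.
move=> Ni fN; have [N0 ND NM] := Ni.
(* Outer induction on the size of [g], inner descending induction on the index [i] of a coefficient
   of [f]. *)
have [n] := ubnP (size g); elim: n g => // n IHn g; rewrite ltnS => szg gfN.
suff fgN i : poly_ext N (f`_i *: g).
  by move=> j; apply: fN => i; rewrite mulrC -coefZ; apply: fgN.
have [m] := ubnP (size f - i); elim: m i => // m IHm i; rewrite ltnS => szi.
have [szf|szf] := leqP (size f) i.
  by rewrite nth_default // scale0r => j; rewrite coef0.
case: n => [|n] in szg IHn *.
  by move: szg; rewrite leqn0 size_poly_eq0 => /eqP ->; rewrite scaler0 => j; rewrite coef0.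
(* In the coefficient of [g * f] at [n + i], the terms with [k < n] involve later coefficients of
   [f] and lie in [N] by the inner induction; those with [k > n] vanish. *)
have lead : N (f`_i * g`_n).
  have := gfN (n + i)%N; rewrite coefM.
  have ni : (n < (n + i).+1)%N by rewrite ltnS leq_addr.
  rewrite (bigD1 (Ordinal ni)) //= addKn mulrC => sumN.
  rewrite -[_ * _](addrK (\sum_(k < (n + i).+1 | k != Ordinal ni) g`_k * f`_(n + i - k))).
  apply: ND => //; apply: ideal_opp => //; apply: ideal_sum => // k.
  rewrite -val_eqE /= neq_ltn => /orP[kn|nk].
    rewrite mulrC -coefZ; apply: IHm; apply: leq_trans szi.
    by rewrite ltn_sub2l // -addnBAC ?(ltnW kn) // -[ltnLHS]add0n ltn_add2r subn_gt0.
  by rewrite nth_default ?mul0r //; apply: leq_trans szg _.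
(* Removing the top term, which lies in [N[X]], lowers the size bound and keeps the product with [f]
   in [N[X]]. *)
have red : poly_ext N (f`_i *: g - (f`_i * g`_n) *: 'X^n).
  apply: IHn => [|].
    rewrite ltnS; apply/leq_sizeP => j nj; rewrite coefB !coefZ coefXn.
    have [->|jn] := eqVneq j n; first by rewrite mulr1 subrr.
    rewrite mulr0 subr0 [g`_j]nth_default ?mulr0 //; apply: leq_trans szg _.
    by rewrite ltn_neqAle eq_sym jn.
  rewrite mulrBl -!scalerAl => j; rewrite coefB !coefZ.
  by apply: ND; [apply: NM; apply: gfN|apply: ideal_opp => //; apply: ideal_mulr].
move=> j; rewrite -[_ *: _](subrK ((f`_i * g`_n) *: 'X^n)) coefD.
by apply: ND; [exact: red|rewrite coefZ; apply: ideal_mulr].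
Qed.

(** The polynomials are placed end to end, shifted by powers of [X], so that their coefficients do
    not overlap. *)
Lemma content_combine I (s : seq {poly D}) : is_ideal I -> (forall f, f \in s -> I f) ->
  exists2 F, I F & forall f, f \in s -> forall i, exists k, F`_k = f`_i.
Proof.
move=> Ii; have [I0 ID IM] := Ii; elim: s => [_|f s IHs sI]; first by exists 0.
have [|F IF FP] := IHs; first by move=> g gs; apply: sI; rewrite inE gs orbT.
exists (f + 'X^(size f) * F).
  by apply: ID; [apply: sI; rewrite mem_head|apply: IM].
move=> g; rewrite inE => /predU1P[->|/FP gP] i; last first.
  have [k <-] := gP i; exists (size f + k)%N.
  by rewrite coefD coefXnM ltnNge leq_addr addKn nth_default ?add0r ?leq_addr.
have [szi|szi] := ltnP i (size f).
  by exists i; rewrite coefD coefXnM szi addr0.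
(* The zero coefficients of [f] beyond its size are matched by one beyond the end of the shifted
   [F]. *)
have [k kP] : exists k, F`_k = 0 by exists (size F); rewrite nth_default.
exists (size f + k)%N; rewrite coefD coefXnM ltnNge leq_addr addKn kP.
by rewrite !nth_default ?addr0 ?leq_addr.
Qed.

(** With [h] of least size, the pseudo-remainder of [f] by [h] lies in [I] and is smaller than [h],
    hence zero; [c] is a power of the leading coefficient of [h]. *)
Lemma minimal_poly I : is_ideal I -> I <> [set 0] ->
  exists h, [/\ I h, h != 0,
    forall f, I f -> f != 0 -> (size h <= size f)%N &
    forall f, I f -> exists c k, c != 0 /\ c *: f = k * h].
Proof.
move=> Ii /(ideal_nonzero Ii)[f0 If0 f00].
have [n] := ubnP (size f0); elim: n f0 If0 f00 => // n IHn h Ih h0 szh.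
have [[f [If fn0 szf]]|hmin] := pselect (exists f, [/\ I f, f != 0 & (size f < size h)%N]).
  by apply: (IHn f) => //; apply: leq_trans szf _.
exists h; split=> // [f If f0'|f If].
  by rewrite leqNgt; apply/negP => szf; apply: hmin; exists f.
exists (lead_coef h ^+ rscalp f h), (rdivp f h).
split; first by rewrite expf_neq0 // lead_coef_eq0.
have E := Pdiv.ComRing.rdivp_eq h f.
have r0 : rmodp f h = 0.
  apply/eqP/negPn/negP => r0; apply: hmin; exists (rmodp f h); split=> //.
    have -> : rmodp f h = lead_coef h ^+ rscalp f h *: f - rdivp f h * h.
      by rewrite E addrAC subrr add0r.
    have [_ ID IM] := Ii; apply: ID.
      by rewrite -mul_polyC; apply: IM.
    by apply: ideal_opp => //; apply: IM.
  exact: ltn_rmodpN0.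
by rewrite E r0 addr0.
Qed.

Lemma prime_polyC_cancel q c f : is_prime_ideal q ->
  (forall d, q d%:P -> d = 0) -> c != 0 -> q (c *: f) -> q f.
Proof.
move=> [_ qp] qD c0; rewrite -mul_polyC => /qp[/qD cE|//].
by rewrite cE eqxx in c0.
Qed.

(** Fraction-free form of the fact that nonzero primes of a polynomial ring over a field are
    maximal: elements of least size act as generators, up to nonzero constants. *)
Lemma upper_maximal q I : is_prime_ideal q -> q <> [set 0] ->
  (forall d, q d%:P -> d = 0) -> is_ideal I -> q `<=` I ->
  (forall d, I d%:P -> d = 0) -> I `<=` q.
Proof.
move=> qp q0 qD Ii qI ID; have [qi _] := qp.1.
have In0 : I <> [set 0].
  by move/(ideal_nonzero qi): q0 => [f qf f0]; apply/(ideal_nonzero Ii); exists f; auto.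
have [m [Im m0 _ mP]] := minimal_poly Ii In0.
have [h [qh h0 hmin _]] := minimal_poly qi q0.
suff qm : q m.
  move=> f /mP[c [k [c0 cE]]]; apply: (prime_polyC_cancel qp qD c0).
  by rewrite cE; case: qi => _ _; apply.
have [c [k [c0 cE]]] := mP _ (qI _ qh).
have qkm : q (k * m) by rewrite -cE -mul_polyC; case: qi => _ _; apply.
have [qk|//] := qp.2 _ _ qkm.
have k0 : k != 0.
  apply/eqP => kE; move/eqP: cE.
  by rewrite kE mul0r -mul_polyC mulf_eq0 polyC_eq0 (negPf c0) (negPf h0).
(* As [I] contains no nonzero constant, [m] is not constant; so the cofactor [k] is smaller than
   [h], and minimality of [h] keeps it out of [q]. *)
have szm : (1 < size m)%N.
  rewrite ltnNge; apply/negP => /size1_polyC mE; move: Im m0; rewrite mE => /ID ->.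
  by rewrite eqxx.
have := hmin _ qk k0; rewrite -(size_scale h c0) cE size_mul // leqNgt.
by case: (size m) szm => [|[|l]] // _; rewrite !addnS /= ltnS leq_addr.
Qed.

End Polynomials.

(** * Localizations of [D[X]] at polynomials with constant term 1 *)

(** The multiplicative set is not a parameter: it is recovered as the set of polynomials with
    constant term 1 that become units in [T]. *)
Definition localization1 (D T : idomainType) (phi : {rmorphism {poly D} -> T}) :=
  injective phi /\ forall t, exists f g : {poly D},
    [/\ g.[0] = 1, phi g \is a GRing.unit & t = phi f / phi g].

Lemma poly_ext_divides (D : idomainType) (y : D) (f : {poly D}) :
  poly_ext [set z | divides y z] f <-> divides y%:P f.
Proof.
split=> [yf|[g ->] i]; last by rewrite /= mul_polyC coefZ; exists g`_i.
have [g gP] := choice yf; exists (\poly_(i < size f) g i).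
apply/polyP => i; rewrite mul_polyC coefZ coef_poly; case: ltnP => // szi.
by rewrite mulr0 nth_default.
Qed.

Section Localization.
Variables (D T : idomainType) (phi : {rmorphism {poly D} -> T}).
Hypothesis phi_loc : localization1 phi.
Implicit Types (N P : set D) (q : set {poly D}) (I Q : set T).
Implicit Types (f g h : {poly D}) (t x y : T).

Let phi_inj : injective phi. Proof. by case: phi_loc. Qed.

Let phi_eq0 f : (phi f == 0) = (f == 0).
Proof. by rewrite -(rmorph0 phi) (inj_eq phi_inj). Qed.

Definition denominator g := g.[0] = 1 /\ phi g \is a GRing.unit.

Lemma denominator1 : denominator 1.
Proof. by split; rewrite ?hornerC // rmorph1 unitr1. Qed.

Lemma denominatorM g h : denominator g -> denominator h -> denominator (g * h).
Proof.
by move=> [g1 gu] [h1 hu]; split; rewrite ?hornerM ?g1 ?h1 ?mulr1 // rmorphM unitrM gu.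
Qed.

Lemma numden t : exists f g, denominator g /\ t = phi f / phi g.
Proof. by have [f [g [g1 gu tE]]] := phi_loc.2 t; exists f, g. Qed.

Lemma numdenM f g h k : denominator g -> denominator k ->
  phi f / phi g * (phi h / phi k) = phi (f * h) / phi (g * k).
Proof. by move=> [_ gu] [_ ku]; rewrite !rmorphM invrM // [_^-1 * _]mulrC mulrACA. Qed.

Definition ext q : set T :=
  [set t | exists f g, [/\ q f, denominator g & t = phi f / phi g]].

Definition ext_base N : set T := ext (poly_ext N).

Definition saturated q := forall f g, denominator g -> q (f * g) -> q f.

Lemma sub_ext q f : q f -> ext q (phi f).
Proof. by move=> qf; exists f, 1; split=> //; [exact: denominator1|rewrite rmorph1 divr1]. Qed.

Lemma ext_preimage q f : saturated q -> is_ideal q -> ext q (phi f) <-> q f.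
Proof.
move=> qs qi; split=> [[h [g [qh gd /(congr1 (fun t => t * phi g))]]]|]; last exact: sub_ext.
rewrite divrK ?gd.2 // -rmorphM => /phi_inj fgE; apply: (qs _ _ gd).
by rewrite fgE.
Qed.

Lemma ext_ideal q : is_ideal q -> is_ideal (ext q).
Proof.
move=> [q0 qD qM]; split=> [|_ _ [f [g [qf gd ->]]] [h [k [qh kd ->]]]|t _ [f [g [qf gd ->]]]].
- by rewrite -(rmorph0 phi); apply: sub_ext.
- exists (k * f + g * h), (g * k); split; [|exact: denominatorM|].
    by apply: qD; apply: qM.
  have [_ gu] := gd; have [_ ku] := kd.
  have gku : phi (g * k) \is a GRing.unit by case: (denominatorM gd kd).
  apply: (mulIr gku); rewrite divrK // mulrDl !rmorphD !rmorphM.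
  by rewrite mulrA divrK // [phi g * phi k]mulrC mulrA divrK // mulrC [X in _ + X = _]mulrC.
- have [h [k [kd ->]]] := numden t; exists (h * f), (k * g).
  split; [exact: qM|exact: denominatorM|].
  exact: numdenM.
Qed.

Lemma ideal_num I f g : is_ideal I -> denominator g -> I (phi f / phi g) <-> I (phi f).
Proof.
move=> Ii [_ gu]; split=> [If|]; last exact: ideal_mulr.
by rewrite -(divrK gu (phi f)); apply: ideal_mulr.
Qed.

Lemma ext_preimageK I : is_ideal I -> I = ext (phi @^-1` I).
Proof.
move=> Ii; apply/seteqP; split=> [t|_ [f [g [If gd ->]]]].
  have [f [g [gd ->]]] := numden t; move/(ideal_num f Ii gd) => If.
  by exists f, g.
by apply/(ideal_num f Ii gd).
Qed.

Lemma sub_preimage I I' : is_ideal I -> is_ideal I' ->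
  phi @^-1` I `<=` phi @^-1` I' -> I `<=` I'.
Proof.
move=> Ii Ii' sII'; rewrite (ext_preimageK Ii) (ext_preimageK Ii').
by move=> _ [f [g [If gd ->]]]; exists f, g; split=> //; apply: sII'.
Qed.

(** A polynomial with constant term 1 has unit content, so McCoy's theorem cancels it modulo any
    ideal. *)
Lemma saturated_poly_ext N : is_ideal N -> saturated (poly_ext N).
Proof.
move=> Ni f g [g1 _]; apply: poly_ext_mul_content => // r /(_ 0).
by rewrite -horner_coef0 g1 mulr1.
Qed.

Lemma saturated_prime q : is_prime_ideal q -> q `&` anderson_set (D := D) = set0 ->
  saturated q.
Proof.
move=> [_ qp] qA f g [g1 _] /qp[//|qg].
by have : (set0 : set {poly D}) g by rewrite -qA.
Qed.

Lemma ext_prime q : is_prime_ideal q -> saturated q -> is_prime_ideal (ext q).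
Proof.
move=> [[qi /(ideal_proper qi) q1] qp] qs; have ei := ext_ideal qi; split.
  split=> //; apply/(ideal_proper ei).
  by rewrite -(rmorph1 phi) => /(ext_preimage _ qs qi).
move=> x y; have [f [g [gd ->]]] := numden x; have [h [k [kd ->]]] := numden y.
rewrite numdenM // => /(ideal_num _ ei (denominatorM gd kd)).
move=> /(ext_preimage _ qs qi) /qp[qf|qh]; [left|right].
  by apply/(ideal_num _ ei gd)/sub_ext.
by apply/(ideal_num _ ei kd)/sub_ext.
Qed.

Lemma ideal_ext_ext q : is_ideal q -> ideal_ext phi q = ext q.
Proof.
move=> qi; apply/seteqP; split.
  by apply: smallest_sub => [|_ [f qf <-]]; [exact: ext_ideal|exact: sub_ext].
have gi := ideal_gen_ideal (phi @` q).
move=> _ [f [g [qf _ ->]]]; apply: (ideal_mulr _ gi).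
by apply: sub_gen_smallest; exists f.
Qed.

Lemma ideal_ext_base N : is_ideal N -> ideal_ext (phi \o @polyC D) N = ext_base N.
Proof.
move=> Ni; have pNi := poly_ext_ideal Ni; apply/seteqP; split.
  apply: smallest_sub => [|_ [r Nr <-]]; first exact: ext_ideal.
  by apply: sub_ext; apply/poly_extC.
have gi := ideal_gen_ideal ((phi \o @polyC D) @` N).
move=> _ [f [g [Nf _ ->]]]; apply: (ideal_mulr _ gi).
rewrite -[f]coefK poly_def rmorph_sum; apply: (ideal_sum _ gi) => i _.
rewrite -mul_polyC rmorphM; apply: (ideal_mulr _ gi).
by apply: sub_gen_smallest; exists f`_i.
Qed.

(** * GV-sequences of localizations *)

(** Clearing denominators changes the entries by units only. *)
Lemma GV_seq_numerators (s : seq T) : GV_seq s -> exists2 s0 : seq {poly D},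
  GV_seq (map phi s0) & forall f, f \in s0 -> exists j g,
    [/\ j \in s, denominator g & phi f = j * phi g].
Proof.
move=> sGV; have [num numP] := choice numden.
exists (map num s) => [|_ /mapP[j js ->]]; last first.
  have [g [gd jE]] := numP j; exists j, g; split=> //.
by rewrite [X in X * _]jE divrK ?gd.2.
apply: GV_seq_divides sGV => j js _; exists (phi (num j)).
  by rewrite map_f // map_f.
by have [g [_ jE]] := numP j; exists (phi g)^-1.
Qed.

Lemma divides_num f h : divides (phi f) (phi h) ->
  exists g, denominator g /\ divides f (h * g).
Proof.
move=> [t]; have [k [g [gd ->]]] := numden t => /(congr1 (fun t => t * phi g)).
rewrite mulrA divrK ?gd.2 // -!rmorphM => /phi_inj hgE.
by exists g; split=> //; exists k.
Qed.

(** If [y] divides [x] times every coefficient of [f], it divides [x] times every member of [s],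
    hence [x] in [T]. So [y] divides some [x * h] in [D[X]] with [h] of constant term 1; constant
    terms then give the divisibility in [D]. *)
Lemma GV_seq_content (s : seq {poly D}) f : GV_seq (map phi s) ->
  (forall g, g \in s -> forall i, exists k, f`_k = g`_i) -> GV_seq (f : seq D).
Proof.
move=> [[_ /mapP[g gs ->] g0] sP] fs; split.
  rewrite phi_eq0 -lead_coef_eq0 in g0; have [k kE] := fs _ gs (size g).-1.
  exists f`_k; last by rewrite kE.
  apply: mem_nth; rewrite ltnNge; apply/negP => szk.
  by move: g0; rewrite lead_coefE -kE nth_default ?eqxx.
move=> x y y0 xyP; have y0' : phi y%:P != 0 by rewrite phi_eq0 polyC_eq0.
have [|h [[h1 _] [k xhE]]] := @divides_num y%:P x%:P.
  apply: (sP _ _ y0') => _ /mapP[h hs ->].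
  have [|u uE] := (poly_ext_divides y (x%:P * h)).1.
    move=> i; rewrite /= mul_polyC coefZ; have [l <-] := fs _ hs i.
    have [szl|szl] := ltnP l (size f); first by apply: xyP; apply: mem_nth.
    by rewrite nth_default // mulr0; apply: divides0.
  by exists (phi u); rewrite -!rmorphM uE.
exists k`_0; have := congr1 (fun p => p.[0]) xhE.
by rewrite /= !hornerM !hornerC h1 mulr1 horner_coef0.
Qed.

(** From [x a = y z] and [x f = y z'] follows [z' a = z f]. McCoy's theorem modulo [a] cancels [f],
    so [a] divides [z] up to denominators, and [y] divides [x]. *)
Lemma content_GV_seq (a : D) f : a != 0 -> GV_seq (f : seq D) ->
  GV_seq [:: phi a%:P; phi f].
Proof.
move=> a0 [_ fP]; have pa0 : phi a%:P != 0 by rewrite phi_eq0 polyC_eq0.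
split=> [|x y y0 xyP]; first by exists (phi a%:P); rewrite ?mem_head.
have [z zE] := xyP _ (mem_head _ _).
have [z' z'E] : divides y (x * phi f) by apply: xyP; rewrite !inE eqxx orbT.
have zz' : z' * phi a%:P = z * phi f.
  by apply: (mulfI y0); rewrite !mulrA -z'E -zE mulrAC.
have [h [g [gd hgE]]] := numden z; have [h' [g' [gd' hgE']]] := numden z'.
have E : h' * a%:P * g = h * g' * f.
  apply: phi_inj; rewrite !rmorphM.
  have -> : phi h = z * phi g by rewrite hgE divrK ?gd.2.
  have -> : phi h' = z' * phi g' by rewrite hgE' divrK ?gd'.2.
  transitivity (z' * phi a%:P * (phi g * phi g')); first by ring.
  by rewrite zz'; ring.
have : poly_ext [set u | divides a u] (h * g').
  apply: (poly_ext_mul_content (f := f) (divides_ideal a)) => [r rf|].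
    by apply: (fP _ _ a0) => _ /(nthP 0)[i _ <-]; apply: rf.
  by apply/poly_ext_divides; exists (h' * g); rewrite -E; ring.
move=> /poly_ext_divides[k kE]; exists (phi k / phi (g * g')).
apply: (mulIf pa0); rewrite zE -mulrA; congr (y * _).
have [_ ggu] := denominatorM gd gd'.
apply: (mulIr ggu); rewrite [RHS]mulrAC divrK // -rmorphM [k * _]mulrC -kE.
by rewrite hgE !rmorphM mulrA divrK ?gd.2.
Qed.

Lemma GV_seq_map (s : seq {poly D}) : GV_seq s -> GV_seq (map phi s).
Proof.
move=> [[f fs f0] sP]; split=> [|x y y0 xyP].
  by exists (phi f); rewrite ?map_f ?phi_eq0.
have [h [g [gd xE]]] := numden x; have [k [l [ld yE]]] := numden y.
have k0 : k != 0 by apply: contra_neq y0 => kE; rewrite yE kE rmorph0 mul0r.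
(* Only finitely many divisibilities occur, so one denominator [d] brings them all down to
   [D[X]]. *)
have [d dd dP] : exists2 d, denominator d & forall f, f \in s -> divides k (h * d * f).
  have : forall f, f \in s -> divides (phi k) (phi (h * f)).
    move=> u us; have [z zE] := xyP _ (map_f phi us).
    exists (z * phi g / phi l); rewrite rmorphM.
    have -> : phi h = x * phi g by rewrite xE divrK ?gd.2.
    by rewrite mulrAC zE yE; ring.
  elim: s {sP xyP f fs f0} => [|u s IHs] sP; first by exists 1; [exact: denominator1|].
  have [|d dd dP] := IHs; first by move=> v vs; apply: sP; rewrite inE vs orbT.
  have [e [ed [z zE]]] := divides_num (sP _ (mem_head _ _)).
  exists (d * e); first exact: denominatorM.
  move=> v; rewrite inE => /predU1P[->|/dP[w wE]].
    by exists (z * d); rewrite [RHS]mulrA -zE; ring.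
  by exists (w * e); rewrite [RHS]mulrA -wE; ring.
have [z zE] := sP _ _ k0 dP; exists (phi z / phi (g * d) * phi l).
have [_ gdu] := denominatorM gd dd.
apply: (mulIr gdu); rewrite !mulrA mulrAC divrK //.
rewrite xE yE rmorphM mulrA divrK ?gd.2 // -rmorphM zE mulrAC.
by rewrite divrK ?ld.2 // rmorphM.
Qed.

(** * [w]-ideals of localizations *)

Lemma preimage_nonzero I : is_ideal I -> I <> [set 0] -> phi @^-1` I <> [set 0].
Proof.
move=> Ii /(ideal_nonzero Ii)[x]; have [f [g [gd ->]]] := numden x.
move=> /(ideal_num f Ii gd) If x0; apply/(ideal_nonzero (ideal_preimage phi Ii)).
by exists f => //; apply: contra_neq x0 => ->; rewrite rmorph0 mul0r.
Qed.

Lemma preimage_w_ideal I : w_ideal I -> w_ideal (phi @^-1` I).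
Proof.
move=> /w_idealP[Ii I0 Iw]; apply/w_idealP; split.
- exact: ideal_preimage.
- exact: preimage_nonzero.
- move=> s f /GV_seq_map sGV fsI; apply: (Iw _ _ sGV) => _ /mapP[g gs ->].
  by rewrite -rmorphM; apply: fsI.
Qed.

(** If the ideal [c] of coefficients contained a GV-sequence of [D], one polynomial [F] with image
    in [I] would carry it among its coefficients, and [a] with [F] would give a GV-sequence inside
    the proper ideal [I]. *)
Lemma w_ideal_sub_ext_base I (a : D) : w_ideal I -> I <> setT ->
  a != 0 -> I (phi a%:P) ->
  exists N, [/\ w_ideal N, N <> setT & phi @^-1` I `<=` poly_ext N].
Proof.
move=> Iw IT a0 Ia; have [Ii _ _] := Iw.
have Ji := ideal_preimage phi Ii; have [J0 JD JM] := Ji.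
pose c := [set r : D | exists f i, I (phi f) /\ r = f`_i].
have ci : is_ideal c.
  split=> [|_ _ [f [i [If ->]]] [g [j [Ig ->]]]|r _ [f [i [If ->]]]].
  - by exists 0, 0; rewrite coef0.
  (* The shifts align the two chosen coefficients at index [i + j]. *)
  - exists ('X^j * f + 'X^i * g), (i + j); split; first by apply: JD; apply: JM.
    by rewrite coefD !coefXnM !ltnNge leq_addl leq_addr addnK addKn.
  - by exists (r%:P * f), i; split; [exact: JM|rewrite mul_polyC coefZ].
have c0 : c <> [set 0].
  by apply/(ideal_nonzero ci); exists a => //; exists a%:P, 0; rewrite coefC.
exists (w_closure c); split; first exact: w_closure_w_ideal.
  apply: w_closure_proper => // s sGV sc.
  have [F IF FP] : exists2 F, I (phi F) & forall r, r \in s -> exists k, F`_k = r.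
    have /choice[p pP] : forall r, exists f, c r -> I (phi f) /\ exists k, f`_k = r.
      move=> r; have [[f [i [If ->]]]|ncr] := pselect (c r); last by exists 0.
      by exists f => _; split=> //; exists i.
    have [|F IF FP] := content_combine (s := map p s) Ji.
      by move=> _ /mapP[r rs ->]; case: (pP _ (sc _ rs)).
    exists F => // r rs; have [_ [k kE]] := pP _ (sc _ rs).
    by rewrite -kE; apply: FP; apply: map_f.
  have FGV : GV_seq (F : seq D).
    apply: GV_seq_divides sGV => r rs r0; exists r; last by exists 1; rewrite mulr1.
    have [k kE] := FP _ rs; rewrite -kE; apply: mem_nth; rewrite ltnNge.
    by apply/negP => szk; move: r0; rewrite -kE nth_default ?eqxx.
  apply: (w_ideal_noGV Iw IT (content_GV_seq a0 FGV)) => j.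
  by rewrite !inE => /orP[]/eqP ->.
by move=> f If i; apply: sub_w_closure => //; exists f, i.
Qed.

Lemma ext_base_ideal N : is_ideal N -> is_ideal (ext_base N).
Proof. by move=> Ni; apply: ext_ideal; apply: poly_ext_ideal. Qed.

Lemma ext_base_preimage N f : is_ideal N -> ext_base N (phi f) <-> poly_ext N f.
Proof.
by move=> Ni; apply: ext_preimage; [exact: saturated_poly_ext|exact: poly_ext_ideal].
Qed.

Lemma ext_baseC N (r : D) : is_ideal N -> ext_base N (phi r%:P) <-> N r.
Proof. by move=> Ni; rewrite -(poly_extC r Ni); apply: ext_base_preimage. Qed.

Lemma ext_base_proper N : is_ideal N -> N <> setT -> ext_base N <> setT.
Proof.
move=> Ni /(ideal_proper Ni) N1; apply/(ideal_proper (ext_base_ideal Ni)).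
by rewrite -(rmorph1 phi) => /(ext_baseC 1 Ni).
Qed.

Lemma ext_base_sub N N' : is_ideal N -> is_ideal N' ->
  ext_base N `<=` ext_base N' -> N `<=` N'.
Proof. by move=> Ni Ni' sNN' r /(ext_baseC r Ni) /sNN' /(ext_baseC r Ni'). Qed.

(** The numerators of a GV-sequence taking [f] into [N[X]] combine into one [F] whose coefficients
    form a GV-sequence of [D]. As [N] is a [w_ideal], McCoy's theorem cancels [F] from [f * F]. *)
Lemma ext_base_w_ideal N : w_ideal N -> w_ideal (ext_base N).
Proof.
move=> /w_idealP[Ni /(ideal_nonzero Ni)[r Nr r0] Nw].
have Ei := ext_base_ideal Ni; apply/w_idealP; split=> //.
  apply/(ideal_nonzero Ei); exists (phi r%:P); last by rewrite phi_eq0 polyC_eq0.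
  exact/ext_baseC.
move=> s x /GV_seq_numerators[s0 s0GV s0P]; have [f [g [gd ->]]] := numden x => xsE.
apply/(ideal_num f Ei gd); apply/(ext_base_preimage f Ni).
have Ci := ideal_colon f (poly_ext_ideal Ni).
have [|F fF FP] := content_combine (s := s0) Ci.
  move=> h /s0P[j [k [js kd hE]]] /=; apply/ext_base_preimage => //.
  rewrite rmorphM hE -(divrK gd.2 (phi f)).
  have -> : phi f / phi g * phi g * (j * phi k) = phi f / phi g * j * (phi g * phi k).
    by ring.
  by apply: ideal_mulr => //; apply: xsE.
apply: (poly_ext_mul_content (f := F) Ni) => // l lF.
apply: (Nw _ _ (GV_seq_content s0GV FP)) => _ /(nthP 0)[i _ <-]; exact: lF.
Qed.

Lemma ext_base_prime N : is_prime_ideal N -> is_prime_ideal (ext_base N).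
Proof.
move=> [[Ni /(ideal_proper Ni) N1] Np]; apply: ext_prime; last exact: saturated_poly_ext.
split.
  split; first exact: poly_ext_ideal.
  by apply/(ideal_proper (poly_ext_ideal Ni)) => /(poly_extC 1 Ni).
(* A coefficient of [g] outside the prime [N] can be cancelled modulo [N], which is McCoy's
   hypothesis on [g]. *)
move=> f g fgN; have [gN|/existsNP[i giN]] := pselect (poly_ext N g); [by right|left].
by apply: (poly_ext_mul_content (f := g) Ni) => // r /(_ i) /Np[].
Qed.

End Localization.

(** * Maximal [w]-ideals and the [w]-Hilbert property *)

Section Hilbert.
Variables (D T : idomainType) (phi : {rmorphism {poly D} -> T}).
Hypothesis phi_loc : localization1 phi.
Implicit Types (N P : set D) (q : set {poly D}) (I Q M : set T).

(** A larger proper [w_ideal] still meets [D], hence lies in some [N'T]; then [N] lies in [N'], and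
    maximality gives equality. *)
Lemma ext_base_maximal N : maximal_w_ideal N -> maximal_w_ideal (ext_base phi N).
Proof.
move=> Nmax; have [Nw NT _] := Nmax; have [Ni N0 _] := Nw.
split; [exact: ext_base_w_ideal|exact: ext_base_proper|].
move=> I Iw IT [NI nIN]; have [Ii _ _] := Iw.
move/(ideal_nonzero Ni): N0 => [a Na a0].
have Ia : I (phi a%:P) by apply: NI; apply/ext_baseC.
have [N' [N'w N'T IN']] := w_ideal_sub_ext_base phi_loc Iw IT a0 Ia.
have [N'i _ _] := N'w; have E : N = N'.
  apply: maximal_w_ideal_sub => // r Nr; apply/(poly_extC r N'i); apply: IN'.
  by apply: NI; apply/ext_baseC.
apply: nIN; apply: (sub_preimage phi_loc) => //; first exact: ext_base_ideal.
by move=> f /IN'; rewrite E => fN'; apply/ext_base_preimage.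
Qed.

Lemma maximal_w_ideal_meet_base M (a : D) :
  maximal_w_ideal M -> a != 0 -> M (phi a%:P) ->
  exists2 N, maximal_w_ideal N & M = ext_base phi N.
Proof.
move=> Mmax a0 Ma; have [Mw MT _] := Mmax; have [Mi _ _] := Mw.
have [N [Nw NT MN]] := w_ideal_sub_ext_base phi_loc Mw MT a0 Ma.
have [Ni _ _] := Nw.
have ME : M = ext_base phi N.
  apply: (maximal_w_ideal_sub Mmax); [exact: ext_base_w_ideal|exact: ext_base_proper|].
  apply: (sub_preimage phi_loc) => //; first exact: ext_base_ideal.
  by move=> f /MN fN; apply/ext_base_preimage.
exists N => //; split=> // N' N'w N'T [NN' nN'N]; have [N'i _ _] := N'w.
apply: nN'N; rewrite (_ : N = N') //; apply/seteqP; split=> //.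
apply: (ext_base_sub phi_loc) => //; rewrite -ME.
rewrite (maximal_w_ideal_sub Mmax (ext_base_w_ideal phi_loc N'w)) //.
  exact: ext_base_proper.
by rewrite ME => _ [f [g [fN gd ->]]]; exists f, g; split=> // i; apply: NN'.
Qed.

(** A proper [w_ideal] strictly above [Q] contains a nonzero constant by [upper_maximal], hence lies
    in some [NT]. Conversely, a maximal [Q] inside [NT] would equal [NT], which contains nonzero
    constants. *)
Lemma upper_maximalP Q : prime_w_ideal Q -> (forall d : D, Q (phi d%:P) -> d = 0) ->
  maximal_w_ideal Q <->
  (forall N, w_ideal N -> N <> setT -> ~ phi @^-1` Q `<=` poly_ext N).
Proof.
move=> [Qp Qw] QD; have [[Qi QT] _] := Qp; have [_ Q0 _] := Qw.
split=> [Qmax N Nw NT QN|QN].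
  have [Ni N0 _] := Nw; move/(ideal_nonzero Ni): N0 => [a Na a0].
  have QE : Q = ext_base phi N.
    apply: (maximal_w_ideal_sub Qmax); [exact: ext_base_w_ideal|exact: ext_base_proper|].
    apply: (sub_preimage phi_loc) => //; first exact: ext_base_ideal.
    by move=> f /QN fN; apply/ext_base_preimage.
  have aE : a = 0 by apply: QD; rewrite QE; apply/ext_baseC.
  by rewrite aE eqxx in a0.
split=> // I Iw IT [QI nIQ]; have [Ii _ _] := Iw.
have ID d : I (phi d%:P) -> d = 0.
  move=> Id; apply/eqP/negPn/negP => d0.
  have [N [Nw NT IN]] := w_ideal_sub_ext_base phi_loc Iw IT d0 Id.
  by apply: (QN _ Nw NT) => f Qf; apply: IN; apply: QI.
apply: nIQ; apply: (sub_preimage phi_loc) => //.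
apply: upper_maximal => //; [exact: prime_preimage|exact: preimage_nonzero| |].
  exact: ideal_preimage.
by move=> f; apply: QI.
Qed.

Lemma ext_base_bigcap (K : set (set D)) : (forall N, K N -> is_ideal N) ->
  ext_base phi (\bigcap_(N in K) N) = \bigcap_(M in ext_base phi @` K) M.
Proof.
move=> Ki; apply/seteqP; split=> [t [f [g [fK gd ->]]] _ [N KN <-]|t Kt].
  by exists f, g; split=> // i; apply: fK.
have [f [g [gd tE]]] := numden phi_loc t; exists f, g; split=> // i N KN.
have Ni := Ki _ KN; have := Kt _ (imageP _ KN); rewrite tE.
move=> /(ideal_num f (ext_base_ideal phi_loc Ni) gd).
by move=> /(ext_base_preimage phi_loc f Ni); apply.
Qed.

(** Common form of the first two assertions of the theorem; an upper to zero appears as a prime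
    without nonzero constants. *)
Definition w_Hilbert_split := w_Hilbert D /\ forall Q, prime_w_ideal Q ->
  (exists2 P, prime_w_ideal P & Q = ext_base phi P) \/
  ((forall d : D, Q (phi d%:P) -> d = 0) /\ maximal_w_ideal Q).

Lemma prime_w_ideal_base P : prime_w_ideal P -> prime_w_ideal (ext_base phi P).
Proof.
by move=> [Pp Pw]; split; [exact: ext_base_prime|exact: ext_base_w_ideal].
Qed.

Lemma ext_base_inj N N' : is_ideal N -> is_ideal N' ->
  ext_base phi N = ext_base phi N' -> N = N'.
Proof.
move=> Ni Ni' E; apply/seteqP; split; apply: (ext_base_sub phi_loc) => //.
  by rewrite E.
by rewrite E.
Qed.

(** Each [M] in [C] is some [NT], and extension commutes with intersection; the intersection of the
    [N] is prime as the contraction of [Q] to [D]. *)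
Lemma bigcap_meet_base Q (C : set (set T)) : prime_w_ideal Q ->
  C `<=` @maximal_w_ideal T -> Q = \bigcap_(M in C) M ->
  (forall M, C M -> exists2 a : D, a != 0 & M (phi a%:P)) ->
  exists K, [/\ K `<=` @maximal_w_ideal D, prime_w_ideal (\bigcap_(N in K) N) &
                Q = ext_base phi (\bigcap_(N in K) N)].
Proof.
move=> [Qp Qw] Cmax QE CD; have [Qi Q0 _] := Qw.
pose K := [set N | maximal_w_ideal N /\ C (ext_base phi N)].
have Kw : K `<=` @w_ideal D by move=> N [[]].
have Ki N : K N -> is_ideal N by move=> /Kw[].
have CE : C = ext_base phi @` K.
  apply/seteqP; split=> [M CM|_ [N [_ CN] <-]//]; have [a a0 Ma] := CD _ CM.
  have [N Nmax ME] := maximal_w_ideal_meet_base (Cmax _ CM) a0 Ma.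
  by exists N => //; split=> //; rewrite -ME.
have {}QE : Q = ext_base phi (\bigcap_(N in K) N) by rewrite ext_base_bigcap // -CE.
have Pi := bigcap_ideal Ki.
exists K; split=> //; first by move=> N [].
split.
  have -> : \bigcap_(N in K) N = (phi \o @polyC D) @^-1` Q.
    apply/seteqP; split=> r; first by move=> Kr; rewrite QE; apply/ext_baseC.
    by rewrite QE => /(ext_baseC phi_loc r Pi).
  exact: prime_preimage.
apply: w_ideal_bigcap => // P0; apply: Q0; rewrite QE P0; apply/seteqP; split.
  move=> _ [f [g [f0 gd ->]]]; have -> : f = 0 by apply/polyP => i; rewrite coef0 f0.
  by rewrite rmorph0 mul0r.
by move=> _ ->; rewrite -P0; case: (ext_base_ideal phi_loc Pi).
Qed.

Lemma w_Hilbert_splitP : w_Hilbert T <-> w_Hilbert_split.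
Proof.
split=> [HT|[HD HQ] Q Qpw]; last first.
  have [[P Ppw QE]|[_ Qmax]] := HQ _ Qpw.
    have [C Cmax PE] := HD _ Ppw; exists (ext_base phi @` C).
      by move=> _ [N /Cmax Nmax <-]; apply: ext_base_maximal.
    by rewrite QE PE ext_base_bigcap // => N /Cmax[[]].
  by exists [set Q]; rewrite ?bigcap_set1 // => _ ->.
split=> [P Ppw|Q Qpw].
  have [_ [Pi P0 _]] := Ppw; move/(ideal_nonzero Pi): P0 => [a Pa a0].
  have [C Cmax PE] := HT _ (prime_w_ideal_base Ppw).
  have [|K [Kmax [_ [Ki _ _]] PK]] := bigcap_meet_base (prime_w_ideal_base Ppw) Cmax PE.
    (* A nonzero constant of [P] lies in every member of [C]. *)
    move=> M CM; exists a => //; have : ext_base phi P (phi a%:P) by apply/ext_baseC.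
    by rewrite PE; apply.
  by exists K => //; apply: ext_base_inj.
have [C Cmax QE] := HT _ Qpw.
have [CD|nCD] := pselect (forall M, C M -> exists2 a : D, a != 0 & M (phi a%:P)).
  have [K [_ Kpw QK]] := bigcap_meet_base Qpw Cmax QE CD.
  by left; exists (\bigcap_(N in K) N).
(* Some member [M] contains no nonzero constant; as it contains [Q], [upper_maximal] forces
   [Q = M]. *)
right; move/existsNP: nCD => [M /not_implyP[CM nMD]].
have MD d : M (phi d%:P) -> d = 0.
  by move=> Md; apply/eqP/negPn/negP => d0; apply: nMD; exists d.
have QM : Q `<=` M by rewrite QE => t; apply.
have QD d : Q (phi d%:P) -> d = 0 by move=> /QM /MD.
split=> //; have [Mw _ _] := Cmax _ CM; have [Mi _ _] := Mw.
have [Qp [Qi Q0 _]] := Qpw.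
suff -> : Q = M by apply: Cmax.
apply/seteqP; split=> //; apply: (sub_preimage phi_loc) => //.
apply: upper_maximal => //; [exact: prime_preimage|exact: preimage_nonzero| |].
  exact: ideal_preimage.
by move=> f; apply: QM.
Qed.

(** * Contraction to [D[X]] *)

Lemma preimage_prime_w_ideal Q : prime_w_ideal Q -> prime_w_ideal (phi @^-1` Q).
Proof. by move=> [Qp Qw]; split; [exact: prime_preimage|exact: preimage_w_ideal]. Qed.

Lemma preimage_denominator Q : is_prime_ideal Q ->
  (forall g : {poly D}, anderson_set g -> phi g \is a GRing.unit) ->
  phi @^-1` Q `&` @anderson_set D = set0.
Proof.
move=> [[Qi /(ideal_proper Qi) Q1] _] Au; apply/seteqP; split=> // g [Qg /Au gu].
by apply: Q1; rewrite -(divrr gu); apply: ideal_mulr.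
Qed.

(** A GV-sequence of [T] in the extension would have numerators [s0] in [q]. This contradicts
    disjointness from [anderson_set] if [q] has no nonzero constant, and the [w_ideal] property of
    [q] otherwise. *)
Lemma ext_prime_w_ideal q : prime_w_ideal q ->
  q `&` @anderson_set D = set0 -> prime_w_ideal (ext phi q).
Proof.
move=> [qp qw] qA; have [[qi qT] _] := qp; have [_ q0 _] := qw.
have qs := saturated_prime (phi := phi) qp qA; have ei := ext_ideal phi_loc qi.
apply: prime_w_idealP; first exact: ext_prime.
  move/(ideal_nonzero qi): q0 => [f qf f0]; apply/(ideal_nonzero ei).
  by exists (phi f); [exact: sub_ext|rewrite -(rmorph0 phi) (inj_eq phi_loc.1)].
move=> s sGV sq; have [s0 s0GV s0P] := GV_seq_numerators phi_loc sGV.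
have s0q f : f \in s0 -> q f.
  move=> /s0P[j [g [js gd fE]]]; apply/(ext_preimage phi_loc f qs qi); rewrite fE.
  by apply: ideal_mulr => //; apply: sq.
have [qD|/existsNP[a /not_implyP[qa /eqP a0]]] := pselect (forall d : D, q d%:P -> d = 0).
  have [h [qh h0 _ hP]] := minimal_poly qi q0.
  (* [c] is the product of the pseudo-division factors; the GV property then makes [phi h] divide
     [phi c%:P]. *)
  have [c c0 cP] : exists2 c : D, c != 0 & forall f, f \in s0 -> divides h (c%:P * f).
    elim: s0 s0q {s0GV s0P} => [_|f s0 IHs s0q]; first by exists 1; rewrite ?oner_eq0.
    have [|c c0 cP] := IHs; first by move=> g gs; apply: s0q; rewrite inE gs orbT.
    have [d [k [d0 dE]]] := hP _ (s0q _ (mem_head _ _)).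
    exists (c * d); first by rewrite mulf_neq0.
    move=> g; rewrite inE polyCM => /predU1P[->|/cP[u uE]].
      by exists (c%:P * k); rewrite -mulrA [d%:P * f]mul_polyC dE; ring.
    by exists (d%:P * u); rewrite mulrCA -uE; ring.
  have : divides (phi h) (phi c%:P).
    case: s0GV => _; apply; first by rewrite -(rmorph0 phi) (inj_eq phi_loc.1).
    by move=> _ /mapP[f /cP[u uE] ->]; exists (phi u); rewrite -!rmorphM uE.
  move=> /(divides_num phi_loc)[g [gd [k kE]]].
  have : q (c%:P * g) by rewrite kE; apply: ideal_mulr.
  move=> /qp.2[/qD cE|qg]; first by rewrite cE eqxx in c0.
  by have : (set0 : set {poly D}) g by rewrite -qA; split=> //; case: gd.
(* Adjoining the constant [a] makes [s0] a GV-sequence already over [D[X]]. *)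
apply: (w_ideal_noGV qw qT (s := a%:P :: s0)); last first.
  by move=> f; rewrite inE => /predU1P[->|/s0q].
split=> [|x y y0 xyP]; first by exists a%:P; rewrite ?mem_head ?polyC_eq0.
have : divides (phi y) (phi x).
  case: s0GV => _; apply; first by rewrite -(rmorph0 phi) (inj_eq phi_loc.1).
  move=> _ /mapP[f fs ->]; have [|u uE] := xyP f; first by rewrite inE fs orbT.
  by exists (phi u); rewrite -!rmorphM uE.
move=> /(divides_num phi_loc)[g [[g1 _] [h hE]]].
have [k kE] := xyP _ (mem_head _ _).
(* From [x a = y k] and [x g = y h] follows [k g = a h]; since [g] has constant term 1, [a] divides
   [k], and [k / a] is the quotient of [x] by [y]. *)
have : poly_ext [set u | divides a u] k.
  apply: (poly_ext_mul_content (f := g) (divides_ideal a)) => [r /(_ 0)|].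
    by rewrite -horner_coef0 g1 mulr1.
  apply/poly_ext_divides; exists h; apply: (mulfI y0).
  by rewrite [LHS]mulrA -kE [RHS]mulrCA -hE; ring.
move=> /poly_ext_divides[l lE]; exists l.
have pa0 : a%:P != 0 by rewrite polyC_eq0.
by apply: (mulIf pa0); rewrite kE lE; ring.
Qed.

End Hilbert.

(** * The two localizations: [D[X]] itself and the Anderson ring *)

Lemma localization1_id (D : idomainType) :
  localization1 (idfun : {rmorphism {poly D} -> {poly D}}).
Proof.
split=> [f g//|f]; exists f, 1; split; rewrite ?hornerC ?unitr1 //.
by rewrite /= divr1.
Qed.

Lemma localization1_anderson (D : idomainType) :
  localization1 (@anderson_of D : {rmorphism {poly D} -> anderson D}).
Proof.
split=> [f g /(congr1 val) /= /eqP|t]; first by rewrite tofrac_eq => /eqP.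
have [f [g [Ag tE]]] := andersonP t; exists f, g; split=> //.
exact: anderson_of_unit.
Qed.

Section Contraction.
Variables (D T : idomainType) (phi : {rmorphism {poly D} -> T}).
Hypothesis phi_loc : localization1 phi.
Let id_loc := localization1_id D.
Local Notation idX := (idfun : {rmorphism {poly D} -> {poly D}}).
Implicit Types (P : set D) (q : set {poly D}) (Q : set T).

Lemma ext_base_id P : is_ideal P -> ext_base idX P = poly_ext P.
Proof.
move=> Pi; apply/seteqP; split=> f; first by move/(ext_base_preimage id_loc f Pi).
by move=> Pf; apply/(ext_base_preimage id_loc f Pi).
Qed.

Lemma preimage_ext_base P : is_ideal P -> phi @^-1` ext_base phi P = ext_base idX P.
Proof.
move=> Pi; rewrite ext_base_id //.
by apply/seteqP; split=> f /(ext_base_preimage phi_loc f Pi).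
Qed.

(** By [upper_maximalP] both sides amount to the same condition on the contraction of [Q]. *)
Lemma preimage_maximal Q : prime_w_ideal Q -> (forall d : D, Q (phi d%:P) -> d = 0) ->
  maximal_w_ideal Q <-> maximal_w_ideal (phi @^-1` Q).
Proof.
move=> Qpw QD; have qpw := preimage_prime_w_ideal phi_loc Qpw.
by rewrite (upper_maximalP phi_loc Qpw QD) (upper_maximalP id_loc qpw QD).
Qed.

(* A polynomial with constant term 1 lies in no [N[X]] with [N] proper. *)
Lemma meets_denominators_maximal q : prime_w_ideal q ->
  q `&` @anderson_set D <> set0 ->
  (forall d : D, q d%:P -> d = 0) /\ maximal_w_ideal q.
Proof.
move=> qpw /eqP/set0P[g [qg g1]]; have [[[qi qT] _] qw] := qpw.
have qN N : w_ideal N -> N <> setT -> ~ q `<=` poly_ext N.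
  move=> [Ni _ _] /(ideal_proper Ni) N1 /(_ _ qg 0).
  by rewrite -horner_coef0 g1.
have qD d : q d%:P -> d = 0.
  move=> qd; apply/eqP/negPn/negP => d0.
  by have [N [Nw NT]] := w_ideal_sub_ext_base id_loc qw qT d0 qd; apply: qN.
by split=> //; apply/(upper_maximalP id_loc qpw qD).
Qed.

(** Each prime of [T] is the extension of its contraction, and both alternatives transfer. Primes of
    [D[X]] that meet [anderson_set] may be lost in [T], but they satisfy the second alternative
    anyway. *)
Lemma w_Hilbert_split_localization : w_Hilbert_split phi <-> w_Hilbert_split idX.
Proof.
split=> -[HD HQ]; split=> // Q Qpw; have [Qp Qw] := Qpw; have [[Qi QT] _] := Qp.
  have [QA|QA] := pselect (Q `&` @anderson_set D = set0); last first.
    by right; apply: meets_denominators_maximal.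
  have Qs := saturated_prime (phi := phi) Qp QA; have QTpw := ext_prime_w_ideal phi_loc Qpw QA.
  have QE : Q = phi @^-1` ext phi Q.
    by apply/seteqP; split=> f; [move=> Qf; apply: sub_ext|move/(ext_preimage phi_loc f Qs Qi)].
  have [[P Ppw PE]|[QD Qmax]] := HQ _ QTpw.
    by have [[[Pi _] _] _] := Ppw; left; exists P; rewrite // QE PE preimage_ext_base.
  right; split; first by move=> d Qd; apply: QD; apply: sub_ext.
  by rewrite QE; apply/preimage_maximal.
have [[P Ppw PE]|[QD Qmax]] := HQ _ (preimage_prime_w_ideal phi_loc Qpw).
  have [[[Pi _] _] _] := Ppw; left; exists P => //.
  by rewrite (ext_preimageK phi_loc Qi) PE ext_base_id.
by right; split=> //; apply/preimage_maximal.
Qed.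

Lemma w_Hilbert_localization : w_Hilbert T <-> w_Hilbert {poly D}.
Proof.
rewrite (w_Hilbert_splitP phi_loc) (w_Hilbert_splitP id_loc).
exact: w_Hilbert_split_localization.
Qed.

End Contraction.

(** * Translation into generated extensions and uppers to zero *)

Lemma upper_to_zeroP (D : idomainType) (q : set {poly D}) : prime_w_ideal q ->
  upper_to_zero q <-> (forall d : D, q d%:P -> d = 0).
Proof.
move=> [qp [[q0 _ _] qn0 _]]; split=> [[_ _ qD] d qd|qD].
  by have : [set 0 : D] d by rewrite -qD.
by split=> //; apply/seteqP; split=> [d /qD|_ ->] //=; rewrite polyC0.
Qed.

Lemma w_Hilbert_polyP (D : idomainType) : w_Hilbert {poly D} <->
  w_Hilbert D /\
  (forall Q : set {poly D}, prime_w_ideal Q ->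
     (exists2 P : set D, prime_w_ideal P & Q = ideal_ext (@polyC D) P) \/
     (upper_to_zero Q /\ maximal_w_ideal Q)).
Proof.
have id_loc := localization1_id D; rewrite (w_Hilbert_splitP id_loc).
split=> -[HD HQ]; split=> // Q Qpw; (have [[P Ppw ->]|[QD Qmax]] := HQ _ Qpw; [left|right]).
- by exists P; rewrite // -(ideal_ext_base id_loc) //; case: Ppw => [[[]]].
- by split=> //; apply/upper_to_zeroP.
- by exists P; rewrite // -(ideal_ext_base id_loc) //; case: Ppw => [[[]]].
- by split=> //; apply/upper_to_zeroP.
Qed.

Lemma w_Hilbert_andersonP (D : idomainType) : w_Hilbert (anderson D) <->
  w_Hilbert D /\
  (forall Q : set (anderson D), prime_w_ideal Q ->
     (exists2 P : set D, prime_w_ideal P &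
        Q = ideal_ext (@anderson_of D \o @polyC D) P) \/
     (exists q : set {poly D},
        [/\ upper_to_zero q, maximal_w_ideal q,
            q `&` @anderson_set D = set0 &
            Q = ideal_ext (@anderson_of D) q])).
Proof.
have A_loc := localization1_anderson D; rewrite (w_Hilbert_splitP A_loc).
split=> -[HD HQ]; split=> // Q Qpw; have [Qp [Qi _ _]] := Qpw.
  have [[P Ppw ->]|[QD Qmax]] := HQ _ Qpw; [left|right].
    by exists P; rewrite // ideal_ext_base //; case: Ppw => [[[]]].
  exists (@anderson_of D @^-1` Q); split.
  - by apply/upper_to_zeroP => //; apply: preimage_prime_w_ideal.
  - by apply/(preimage_maximal A_loc).
  - by apply: preimage_denominator => //; apply: anderson_of_unit.
  - rewrite ideal_ext_ext //; first exact: ext_preimageK.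
    exact: ideal_preimage.
have [[P Ppw ->]|[q [[qp q0 qD] qmax qA QE]]] := HQ _ Qpw; [left|right].
  by exists P; rewrite // ideal_ext_base //; case: Ppw => [[[]]].
have [[qi _] _] := qp; have qs := saturated_prime (phi := @anderson_of D) qp qA.
have {}QE : @anderson_of D @^-1` Q = q.
  by rewrite QE ideal_ext_ext //; apply/seteqP; split=> f /(ext_preimage A_loc f qs qi).
have QD (d : D) : Q (anderson_of d%:P) -> d = 0.
  by move=> Qd; have : [set 0 : D] d by rewrite -qD -QE.
by split=> //; apply/(preimage_maximal A_loc) => //; rewrite QE.
Qed.

Theorem theorem3p2 (D : idomainType) :
  [<->
    (* (1) *)
    w_Hilbert D /\
    (forall Q : set {poly D}, prime_w_ideal Q ->
       (exists2 P : set D, prime_w_ideal P & Q = ideal_ext (@polyC D) P) \/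
       (upper_to_zero Q /\ maximal_w_ideal Q));
    (* (2) *)
    w_Hilbert D /\
    (forall Q : set (anderson D), prime_w_ideal Q ->
       (exists2 P : set D, prime_w_ideal P &
          Q = ideal_ext (@anderson_of D \o @polyC D) P) \/
       (exists q : set {poly D},
          [/\ upper_to_zero q, maximal_w_ideal q,
              q `&` @anderson_set D = set0 &
              Q = ideal_ext (@anderson_of D) q]));
    (* (3) *)
    w_Hilbert {poly D};
    (* (4) *)
    w_Hilbert (anderson D)].
Proof.
have HAX := w_Hilbert_localization (localization1_anderson D).
have HX := w_Hilbert_polyP D; have HA := w_Hilbert_andersonP D.
(* Every implication goes through the equivalence of the two Hilbert properties. *)
tfae.
- by move=> /HX /HAX /HA.
- by move=> /HA /HAX.
- by move=> /HAX.
- by move=> /HAX /HX.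
Qed.
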